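(* Let $3\le\alpha<\omega$. Let $\Sigma$ be any equational axiom system for the equations true in $\mathcal{F}m^+/\!\equiv$, i.e., any set of equations that are true in $\mathcal{F}m^+/\!\equiv$ and from which every equation true in $\mathcal{F}m^+/\!\equiv$ is derivable. Then for each natural number $n$, $\Sigma$ contains an equation in which $n$ distinct algebraic variables occur together with at least one transposition operation $p_{ij}$, at least one cylindrification operation $c_k$ and at least one diagonal constant $d_{lm}$.
   Context: $\alpha$ is a finite ordinal, $\alpha\ge 3$. Consider first-order logic with equality with exactly the variables $v_i$ $(i<\alpha)$, with a vocabulary containing infinitely many $\alpha$-place relation symbols and possibly other relation symbols of smaller arity, but no function or constant symbols. The logical connectives are $\lor,\neg,\exists v_i$, and $v_i=v_j$ (the latter regarded as a nullary connective) for $i,j<\alpha$. The formula algebra $\mathcal{F}m$ has as universe the set of all formulas (possibly with free variables) and operations $+,-,c_i,d_{ij}$ given by $\varphi+\psi=(\varphi\lor\psi)$, $-\varphi=\neg\varphi$, $c_i\varphi=\exists v_i\varphi$, and the constant $d_{ij}$ is the formula $v_i=v_j$. For $i,j<\alpha$, $p_{ij}$ is the unary function on formulas interchanging all occurrences (free, bound, and in quantifiers) of the variables $v_i$ and $v_j$; $\mathcal{F}m^+$ is $\mathcal{F}m$ expanded with the unary operations $p_{ij}$ $(i,j<\alpha)$. For formulas, $\varphi\equiv\psi$ means that $\varphi\leftrightarrow\psi$ is logically valid; $\equiv$ is a congruence of $\mathcal{F}m^+$, and $\mathcal{F}m^+/\!\equiv$ is the quotient algebra. Equations are in the language $+,-,c_i,d_{ij},p_{ij}$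 $(i,j<\alpha)$; algebraic variables range over elements of the algebra. The $c_i$ are called cylindrifications, the $d_{ij}$ diagonal constants, the $p_{ij}$ transposition operations. *)

(* Defs.v *)
From mathcomp Require Import all_boot fingroup perm.
From mathcomp Require Import generic_quotient boolp classical_sets cardinality.

Set Implicit Arguments.
Unset Strict Implicit.
Unset Printing Implicit Defensive.

Local Open Scope quotient_scope.

Inductive fml (n : nat) (Rel : Type) (ar : Rel -> nat) : Type :=
| FRel (r : Rel) of (ar r).-tuple 'I_n
| FEq of 'I_n & 'I_n
| FOr of fml n ar & fml n ar
| FNeg of fml n ar
| FEx of 'I_n & fml n ar.

Arguments FRel {n Rel ar} r _.
Arguments FEq {n Rel ar} _ _.

Definition FImp n Rel ar (phi psi : @fml n Rel ar) := FOr (FNeg phi) psi.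
Definition FAnd n Rel ar (phi psi : @fml n Rel ar) :=
  FNeg (FOr (FNeg phi) (FNeg psi)).
Definition FIff n Rel ar (phi psi : @fml n Rel ar) :=
  FAnd (FImp phi psi) (FImp psi phi).

(* All occurrences are renamed, including bound ones and those in
   quantifiers. *)
Fixpoint fswap n Rel ar (i j : 'I_n) (phi : @fml n Rel ar) : fml n ar :=
  match phi with
  | FRel r t => FRel r (map_tuple (tperm i j) t)
  | FEq k l => FEq (tperm i j k) (tperm i j l)
  | FOr p q => FOr (fswap i j p) (fswap i j q)
  | FNeg p => FNeg (fswap i j p)
  | FEx k p => FEx (tperm i j k) (fswap i j p)
  end.

(* dom_pt makes the domain nonempty. *)
Record model (Rel : Type) (ar : Rel -> nat) : Type := Model {
  dom :> Type;
  dom_pt : dom;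
  interp : forall r : Rel, (ar r).-tuple dom -> Prop
}.

Definition upd n (M : Type) (s : 'I_n -> M) (k : 'I_n) (a : M) : 'I_n -> M :=
  fun i => if i == k then a else s i.

Fixpoint sat n Rel ar (M : model ar) (s : 'I_n -> M) (phi : @fml n Rel ar)
    : Prop :=
  match phi with
  | FRel r t => interp (map_tuple s t)
  | FEq k l => s k = s l
  | FOr p q => sat s p \/ sat s q
  | FNeg p => ~ sat s p
  | FEx k p => exists a : M, sat (upd s k a) p
  end.

Definition valid n Rel ar (phi : @fml n Rel ar) : Prop :=
  forall (M : model ar) (s : 'I_n -> M), sat s phi.

Definition lequiv n Rel ar (phi psi : @fml n Rel ar) : Prop :=
  valid (FIff phi psi).

Lemma lequivP n Rel ar (phi psi : @fml n Rel ar) :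
  lequiv phi psi <-> forall (M : model ar) (s : 'I_n -> M),
                       sat s phi <-> sat s psi.
Proof.
by split=> H M s; have := H M s => /=;
  case: (pselect (sat s phi)); case: (pselect (sat s psi)); tauto.
Qed.

Lemma sat_fswap n Rel ar (i j : 'I_n) (phi : @fml n Rel ar) (M : model ar)
    (s : 'I_n -> M) :
  sat s (fswap i j phi) <-> sat (s \o tperm i j) phi.
Proof.
elim: phi s => [r t|k l|p IHp q IHq|p IHp|k p IHp] s //=.
- suff -> : map_tuple s (map_tuple (tperm i j) t)
          = map_tuple (s \o tperm i j) t by [].
  by apply: val_inj => /=; rewrite -map_comp.
- by rewrite IHp IHq.
- by rewrite IHp.
- have E a : upd s (tperm i j k) a \o tperm i j = upd (s \o tperm i j) k a.
    by apply: funext => x; rewrite /upd /= (inj_eq perm_inj).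
  by split=> -[a]; rewrite ?IHp ?E => H; exists a; rewrite ?IHp ?E.
Qed.

(* Algebras in the language +, -, c_i, d_ij, p_ij. *)
Record alg (n : nat) : Type := Alg {
  car :> Type;
  aadd : car -> car -> car;
  aneg : car -> car;
  acyl : 'I_n -> car -> car;
  adiag : 'I_n -> 'I_n -> car;
  aswap : 'I_n -> 'I_n -> car -> car
}.

Definition Fm_plus n Rel ar : alg n :=
  @Alg n (@fml n Rel ar)
    (@FOr n Rel ar) (@FNeg n Rel ar) (@FEx n Rel ar) FEq (@fswap n Rel ar).

Definition lequivb n Rel ar : rel {classic @fml n Rel ar} :=
  fun phi psi => `[< lequiv phi psi >].

Lemma lequivb_equiv n Rel ar : equiv_class_of (@lequivb n Rel ar).
Proof.
split.
- by move=> p; apply/asboolP/lequivP.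
- move=> p q; apply/asboolP/asboolP => /lequivP H; apply/lequivP => M s;
    by rewrite H.
- move=> q p r /asboolP/lequivP H /asboolP/lequivP K; apply/asboolP/lequivP.
  by move=> M s; rewrite H K.
Qed.

Canonical lequivb_rel n Rel ar := EquivRelPack (@lequivb_equiv n Rel ar).

Definition Fm_quot n Rel ar : Type := {eq_quot (@lequivb n Rel ar)}.

Definition fclass n Rel ar (phi : @fml n Rel ar) : @Fm_quot n Rel ar :=
  (\pi_{eq_quot (@lequivb n Rel ar)} (phi : {classic fml n ar})).

Definition frepr n Rel ar (x : @Fm_quot n Rel ar) : @fml n Rel ar :=
  (repr (x : {eq_quot (@lequivb n Rel ar)}) : {classic fml n ar}).

Lemma fclassP n Rel ar (phi psi : @fml n Rel ar) :
  fclass phi = fclass psi <-> lequiv phi psi.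
Proof.
split=> [/eqmodP /asboolP //|H]; by apply/eqmodP/asboolP.
Qed.

Lemma freprK n Rel ar (x : @Fm_quot n Rel ar) : fclass (frepr x) = x.
Proof. exact: reprK. Qed.

(* The operations are computed on representatives; the lemmas fclass_or to
   fclass_swap below show that fclass is a homomorphism, hence that the choice
   of representatives is immaterial. *)
Definition Fm_plus_quot n Rel ar : alg n :=
  @Alg n (@Fm_quot n Rel ar)
    (fun x y => fclass (FOr (frepr x) (frepr y)))
    (fun x => fclass (FNeg (frepr x)))
    (fun i x => fclass (FEx i (frepr x)))
    (fun i j => fclass (FEq i j))
    (fun i j x => fclass (fswap i j (frepr x))).

Lemma frepr_fclass n Rel ar (phi : @fml n Rel ar) (M : model ar)
    (s : 'I_n -> M) : sat s (frepr (fclass phi)) <-> sat s phi.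
Proof. by apply: (lequivP _ _).1; apply/fclassP; rewrite freprK. Qed.

Lemma fclass_or n Rel ar (phi psi : @fml n Rel ar) :
  aadd (a := Fm_plus_quot n ar) (fclass phi) (fclass psi)
  = fclass (aadd (a := Fm_plus n ar) phi psi).
Proof. by apply/fclassP/lequivP => M s /=; rewrite !frepr_fclass. Qed.

Lemma fclass_neg n Rel ar (phi : @fml n Rel ar) :
  aneg (a := Fm_plus_quot n ar) (fclass phi)
  = fclass (aneg (a := Fm_plus n ar) phi).
Proof. by apply/fclassP/lequivP => M s /=; rewrite !frepr_fclass. Qed.

Lemma fclass_cyl n Rel ar (i : 'I_n) (phi : @fml n Rel ar) :
  acyl (a := Fm_plus_quot n ar) i (fclass phi)
  = fclass (acyl (a := Fm_plus n ar) i phi).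
Proof.
apply/fclassP/lequivP => M s /=.
by split=> -[a H]; exists a; move: H; rewrite frepr_fclass.
Qed.

Lemma fclass_diag n Rel (ar : Rel -> nat) (i j : 'I_n) :
  adiag (Fm_plus_quot n ar) i j = fclass (adiag (Fm_plus n ar) i j).
Proof. by []. Qed.

Lemma fclass_swap n Rel ar (i j : 'I_n) (phi : @fml n Rel ar) :
  aswap (a := Fm_plus_quot n ar) i j (fclass phi)
  = fclass (aswap (a := Fm_plus n ar) i j phi).
Proof.
by apply/fclassP/lequivP => M s; rewrite !sat_fswap frepr_fclass.
Qed.

Inductive term (n : nat) : Type :=
| TVar of nat
| TAdd of term n & term n
| TNeg of term n
| TCyl of 'I_n & term n
| TDiag of 'I_n & 'I_n
| TSwap of 'I_n & 'I_n & term n.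

Arguments TVar {n} _.

Record equation (n : nat) : Type := Eqn { lhs : term n; rhs : term n }.

Fixpoint teval n (A : alg n) (v : nat -> A) (t : term n) : A :=
  match t with
  | TVar x => v x
  | TAdd t1 t2 => aadd (teval v t1) (teval v t2)
  | TNeg t1 => aneg (teval v t1)
  | TCyl i t1 => acyl i (teval v t1)
  | TDiag i j => adiag A i j
  | TSwap i j t1 => aswap i j (teval v t1)
  end.

Definition true_in n (A : alg n) (e : equation n) : Prop :=
  forall v : nat -> A, teval v (lhs e) = teval v (rhs e).

Fixpoint tsubst n (f : nat -> term n) (t : term n) : term n :=
  match t with
  | TVar x => f x
  | TAdd t1 t2 => TAdd (tsubst f t1) (tsubst f t2)
  | TNeg t1 => TNeg (tsubst f t1)
  | TCyl i t1 => TCyl i (tsubst f t1)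
  | TDiag i j => TDiag i j
  | TSwap i j t1 => TSwap i j (tsubst f t1)
  end.

(* Birkhoff's rules of equational logic. *)
Inductive derives n (S : set (equation n)) : term n -> term n -> Prop :=
| der_ax e f : S e -> derives S (tsubst f (lhs e)) (tsubst f (rhs e))
| der_refl t : derives S t t
| der_sym t u : derives S t u -> derives S u t
| der_trans t u w : derives S t u -> derives S u w -> derives S t w
| der_add t t' u u' : derives S t t' -> derives S u u' ->
    derives S (TAdd t u) (TAdd t' u')
| der_neg t t' : derives S t t' -> derives S (TNeg t) (TNeg t')
| der_cyl i t t' : derives S t t' -> derives S (TCyl i t) (TCyl i t')
| der_swap i j t t' : derives S t t' ->
    derives S (TSwap i j t) (TSwap i j t').

Definition axiomatizes n (S : set (equation n)) (A : alg n) : Prop :=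
  (forall e, S e -> true_in A e) /\
  (forall e, true_in A e -> derives S (lhs e) (rhs e)).

Fixpoint tvars n (t : term n) : seq nat :=
  match t with
  | TVar x => [:: x]
  | TAdd t1 t2 => tvars t1 ++ tvars t2
  | TNeg t1 | TCyl _ t1 | TSwap _ _ t1 => tvars t1
  | TDiag _ _ => [::]
  end.

Definition eqn_vars n (e : equation n) : seq nat :=
  tvars (lhs e) ++ tvars (rhs e).

Fixpoint has_swap n (i j : 'I_n) (t : term n) : bool :=
  match t with
  | TVar _ | TDiag _ _ => false
  | TAdd t1 t2 => has_swap i j t1 || has_swap i j t2
  | TNeg t1 | TCyl _ t1 => has_swap i j t1
  | TSwap k l t1 => (k == i) && (l == j) || has_swap i j t1
  end.

Fixpoint has_cyl n (i : 'I_n) (t : term n) : bool :=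
  match t with
  | TVar _ | TDiag _ _ => false
  | TAdd t1 t2 => has_cyl i t1 || has_cyl i t2
  | TNeg t1 | TSwap _ _ t1 => has_cyl i t1
  | TCyl k t1 => (k == i) || has_cyl i t1
  end.

Fixpoint has_diag n (i j : 'I_n) (t : term n) : bool :=
  match t with
  | TVar _ => false
  | TAdd t1 t2 => has_diag i j t1 || has_diag i j t2
  | TNeg t1 | TCyl _ t1 | TSwap _ _ t1 => has_diag i j t1
  | TDiag k l => (k == i) && (l == j)
  end.

(* Main.v *)
Require Import Defs.
From mathcomp Require Import all_boot.
From mathcomp Require Import boolp classical_sets cardinality.
From mathcomp Require Import functions fingroup perm ssralg zmodp zify.

(** Fix [n].  If every equation of Sigma lacked one of the four ingredients, a
    single algebra that satisfies all true equations with at most [n] variables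
    and all true equations without transpositions, without cylindrifications
    or without diagonals would satisfy everything derivable from Sigma.  So it
    suffices to find such an algebra A in which some true equation fails.

    Truth of an equation in the algebra of formulas is truth in all full set
    algebras over a base M ([true_in_formulas], [true_in_sets]): the infinitely
    many relation symbols of maximal arity can be interpreted independently.

    A is obtained by splitting.  Let N be even.  The base consists of N + 1
    vertices, of the bijections from the vertices to N + 1 labels, and of
    infinitely many fillers; its automorphisms are induced by all permutations
    of the vertices and of the fillers.  Call a sequence generic if it is
    injective and consists of two vertices and otherwise of fillers.  An
    element of A is an automorphism invariant set of sequences in which each
    generic sequence may in addition carry any of N colours; the
    cylindrifications forget colours and the transpositions keep them.

    Where A fails.  Look at a colour class as a relation between two vertices,
    the fillers being fixed.  The classes are symmetric, disjoint,
    irreflexive, and each vertex has a neighbour in each of the N classes.  A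
    bijection to the labels is present as an element of the base, so three
    variables suffice to say that there are at most N + 1 vertices.  In a
    genuine set algebra each class would then be a perfect matching of N + 1
    points, which is impossible since N + 1 is odd ([no_even_factorization]).
    An equation expresses this ([factorization_true_in_sets],
    [factorization_fails]).

    Where A agrees with set algebras.  Any colouring of sequences yields a map
    Y |-> (sequences s such that Y holds at s with the colour of s) from A to
    a set algebra.  It always preserves the Boolean operations; it preserves
    the transpositions if the colouring is symmetric, the cylindrifications if
    each line of generic sequences meets all colours, and the diagonals if no
    points of the base are duplicated ([teval_coloured]).  If moreover every
    colour is attained up to automorphism, then the map is injective.  Any two
    of the three demands can be met, and for few variables all of them.
    - Without cylindrifications, take the constant colourings: their maps are
      jointly injective.
    - Without diagonals, replace each point by infinitely many copies and add
      up the indices of the copies modulo N.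
    - Without transpositions, two vertices x, y in this order get the colour
      y - x in Z/(N+1), which takes each of the N nonzero values once on each
      line, and the fillers are added modulo N.
    - With at most [n] variables, the values of the variables do not tell all
      the N colours apart: they factor through at most R colours, where R
      depends on [n] and the dimension only.  For N = 2R the sum of all the
      entries modulo R is a symmetric colouring whose R values all occur on
      each line: among the N + 1 vertices each residue occurs at least twice,
      and only one vertex is excluded. *)

Set Implicit Arguments.
Unset Strict Implicit.
Unset Printing Implicit Defensive.

Local Open Scope classical_set_scope.
Import GRing.Theory.

(** * Equational logic relative to a subuniverse *)

Definition closed_under_ops al (A : alg al) (K : A -> Prop) : Prop :=
  [/\ forall x y, K x -> K y -> K (aadd x y),
      forall x, K x -> K (aneg x),
      forall i x, K x -> K (acyl i x),
      forall i j, K (adiag A i j)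
    & forall i j x, K x -> K (aswap i j x)].

Lemma teval_closed al (A : alg al) (K : A -> Prop) (t : term al) v :
  closed_under_ops K -> (forall x, x \in tvars t -> K (v x)) ->
  K (teval v t).
Proof.
move=> [Kadd Kneg Kcyl Kdiag Kswap].
elim: t => [x|t IHt u IHu|t IHt|i t IHt|i j|i j t IHt] /= Kv.
- by apply: Kv; rewrite inE.
- by apply: Kadd; [apply: IHt|apply: IHu] => x xin; apply: Kv;
    rewrite mem_cat xin ?orbT.
- exact/Kneg/IHt.
- exact/Kcyl/IHt.
- exact: Kdiag.
- exact/Kswap/IHt.
Qed.

Lemma teval_tsubst al (A : alg al) (v : nat -> A) f (t : term al) :
  teval v (tsubst f t) = teval (fun x => teval v (f x)) t.
Proof.
by elim: t => //= [t -> u -> | t -> | i t -> | i j t ->].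
Qed.

(** Working with a set [K] of admissible elements instead of a subtype avoids
    building the split algebra as a separate record. *)
Lemma derives_sound al (A : alg al) (K : A -> Prop) S (t u : term al) :
  closed_under_ops K ->
  (forall e v, S e -> (forall x, K (v x)) ->
     teval v (lhs e) = teval v (rhs e)) ->
  derives S t u -> forall v : nat -> A, (forall x, K (v x)) ->
  teval v t = teval v u.
Proof.
move=> Kcl KS; elim=> {t u} /=.
- move=> e f Se v Kv; rewrite !teval_tsubst; apply: KS => // x.
  exact: teval_closed.
- by [].
- by move=> t u _ IH v Kv; rewrite IH.
- by move=> t u w _ IH _ IH' v Kv; rewrite IH // IH'.
- by move=> t t' u u' _ IH _ IH' v Kv; rewrite IH // IH'.
- by move=> t t' _ IH v Kv; rewrite IH.
- by move=> i t t' _ IH v Kv; rewrite IH.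
- by move=> i j t t' _ IH v Kv; rewrite IH.
Qed.

(** * Set algebras, and truth in the algebra of formulas *)

(** For [C := unit] this is the full set algebra over [M].  For larger [C] the
    transpositions fix the colour and the cylindrifications forget it, so that
    every sequence is split into as many copies as there are colours. *)
Definition calg al (M C : Type) : alg al :=
  @Alg al (('I_al -> M) -> C -> Prop)
    (fun Y Z s c => Y s c \/ Z s c)
    (fun Y s c => ~ Y s c)
    (fun k Y s c => exists a d, Y (upd s k a) d)
    (fun k l s c => s k = s l)
    (fun k l Y s c => Y (s \o tperm k l) c).

Lemma calg_ext al M C (Y Z : calg al M C) :
  (forall s c, Y s c <-> Z s c) -> Y = Z.
Proof.
by move=> YZ; apply: funext => s; apply: funext => c; apply: propext.
Qed.

Lemma sat_teval al Rel (ar : Rel -> nat) (f : nat -> fml al ar) t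
    (M : model ar) s :
  sat s (teval (A := Fm_plus al ar) f t) <->
  teval (A := calg al M unit) (fun x s _ => sat s (f x)) t s tt.
Proof.
elim: t s => [x|t IHt u IHu|t IHt|i t IHt|i j|i j t IHt] s //=.
- by rewrite IHt IHu.
- by rewrite IHt.
- split=> [[a]|[a [[]]]]; first by rewrite IHt; exists a, tt.
  by move=> /IHt; exists a.
- by rewrite sat_fswap IHt.
Qed.

Lemma teval_fclass al Rel (ar : Rel -> nat) (f : nat -> fml al ar) t :
  teval (A := Fm_plus_quot al ar) (fun x => fclass (f x)) t
  = fclass (teval (A := Fm_plus al ar) f t).
Proof.
elim: t => [x|t IHt u IHu|t IHt|i t IHt|i j|i j t IHt] //=.
- by rewrite IHt IHu; apply: fclass_or.
- by rewrite IHt; apply: fclass_neg.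
- by rewrite IHt; apply: fclass_cyl.
- by rewrite IHt; apply: fclass_swap.
Qed.

Lemma true_in_formulas al Rel (ar : Rel -> nat) (e : equation al) :
  (forall M, true_in (calg al M unit) e) -> true_in (Fm_plus_quot al ar) e.
Proof.
move=> He v.
have -> : v = fun x => fclass (frepr (v x)).
  by apply: funext => x; rewrite freprK.
rewrite !teval_fclass; apply/fclassP/lequivP => M s.
by rewrite !sat_teval He.
Qed.

(** A valuation in a set algebra is imitated by choosing distinct relation
    symbols of full arity for the variables and interpreting them by the given
    relations. *)
Lemma true_in_sets al Rel (ar : Rel -> nat) (e : equation al) :
  0 < al -> infinite_set [set r : Rel | ar r = al] ->
  true_in (Fm_plus_quot al ar) e ->
  forall M, true_in (calg al M unit) e.
Proof.
case: al ar e => // al ar e _ ar_inf He M w.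
have /infiniteP/card_leP[g] := ar_inf.
pose nn x : set_type [set: nat] := exist _ x (mem_set (I : [set: nat] x)).
pose r x : Rel := val (g (nn x)).
have arr x : ar (r x) = al.+1 by apply: set_mem (valP (g (nn x))).
have r_inj x y : r x = r y -> x = y.
  move=> /val_inj rxy.
  have : nn x = nn y by apply: (@inj _ _ _ g) rxy; apply/mem_set.
  by move=> /(congr1 val).
apply: calg_ext => s [].
pose N := @Model Rel ar M (s ord0)
  (fun q t => exists2 x, r x = q & w x (fun i => nth (s ord0) t i) tt).
pose f x : fml al.+1 ar :=
  FRel (r x) [tuple cast_ord (arr x) i | i < ar (r x)].
have fE x s' : sat (M := N) s' (f x) <-> w x s' tt.
  rewrite /f /=.
  have E : (fun i : 'I_al.+1 => nth (s ord0)
      (map s' [seq cast_ord (arr x) i | i : 'I_(ar (r x))]) i) = s'.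
    apply: funext => i.
    have io : i < ar (r x) by rewrite arr.
    rewrite -map_comp (nth_map (Ordinal io)) ?size_enum_ord //=.
    by congr s'; apply: val_inj; rewrite /= nth_enum_ord.
  split=> [[y /r_inj ->]|wx]; first by rewrite E.
  by exists x => //; rewrite E.
have wE : w = fun x s' _ => sat (M := N) s' (f x).
  by apply: funext => x; apply: calg_ext => s' []; rewrite fE.
have := He (fun x => fclass (f x)).
rewrite !teval_fclass => /fclassP/lequivP/(_ N s).
by rewrite !sat_teval wE.
Qed.

(** * Colourings as maps to set algebras *)

(** Exactly what is needed for [teval_coloured] to commute with the [k]-th
    cylindrification: a witness of any colour in the coloured algebra must be
    replaceable by one whose colour is the one that [col] prescribes. *)
Definition lines_full al M U C (K : calg al U C -> Prop) (pi : M -> U)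
    (col : ('I_al -> M) -> C) (k : 'I_al) : Prop :=
  forall s a c, exists b, forall Y, K Y ->
    Y (upd (pi \o s) k a) c -> Y (pi \o upd s k b) (col (upd s k b)).

Lemma comp_upd al M U (pi : M -> U) (s : 'I_al -> M) k b :
  pi \o upd s k b = upd (pi \o s) k (pi b).
Proof. by apply: funext => j; rewrite /upd /=; case: ifP. Qed.

(** Each operation of the language imposes its own demand on the colouring;
    demands for operations that do not occur in [t] are void.  This is what
    makes it possible to treat the four kinds of equations uniformly. *)
Lemma teval_coloured al M U C (K : calg al U C -> Prop) (pi : M -> U)
    (col : ('I_al -> M) -> C) (v : nat -> calg al U C) (t : term al) :
  closed_under_ops K -> (forall x, x \in tvars t -> K (v x)) ->
  (forall i j, has_swap i j t -> forall s, col (s \o tperm i j) = col s) ->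
  (forall k, has_cyl k t -> lines_full K pi col k) ->
  (forall l m, has_diag l m t -> injective pi) ->
  forall s, teval (A := calg al M unit)
              (fun x s _ => v x (pi \o s) (col s)) t s tt
            <-> teval v t (pi \o s) (col s).
Proof.
move=> Kcl; elim: t => [x|t IHt u IHu|t IHt|k t IHt|i j|i j t IHt] //=
  Kv Hswap Hcyl Hdiag s.
- rewrite IHt ?IHu //.
  + by move=> x xu; apply: Kv; rewrite mem_cat xu orbT.
  + by move=> i j ij; apply: (Hswap i j); rewrite ij orbT.
  + by move=> k Hk; apply: Hcyl; rewrite Hk orbT.
  + by move=> l m lm; apply: (Hdiag l m); rewrite lm orbT.
  + by move=> x xu; apply: Kv; rewrite mem_cat xu.
  + by move=> i j ij; apply: (Hswap i j); rewrite ij.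
  + by move=> k Hk; apply: Hcyl; rewrite Hk.
  + by move=> l m lm; apply: (Hdiag l m); rewrite lm.
- by rewrite IHt.
- have IH s' := IHt Kv Hswap (fun j Hj => Hcyl j (introT orP (or_intror Hj)))
    Hdiag s'.
  split=> [[b [[] /IH]]|[a [c H]]].
    by rewrite comp_upd => H; exists (pi b), (col (upd s k b)).
  have [|b Hb] := Hcyl k _ s a c; first by rewrite eqxx.
  by exists b, tt; apply/IH; apply: Hb => //; apply: teval_closed.
- by split=> [->|] //; apply: (Hdiag i j); rewrite !eqxx.
- rewrite IHt //; last first.
    by move=> k l kl; apply: (Hswap k l); rewrite kl orbT.
  by rewrite (Hswap i j) ?eqxx.
Qed.

(** The last hypothesis says that the map induced by [col] is injective at the
    coloured sequence [(s, c)].  It is required at a single [(s, c)] so that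
    [col] may be chosen depending on it. *)
Lemma coloured_transfer al M U C (K : calg al U C -> Prop) (pi : M -> U)
    (col : ('I_al -> M) -> C) (v : nat -> calg al U C) (e : equation al) :
  true_in (calg al M unit) e ->
  closed_under_ops K -> (forall x, x \in eqn_vars e -> K (v x)) ->
  (forall i j, has_swap i j (lhs e) || has_swap i j (rhs e) ->
     forall s, col (s \o tperm i j) = col s) ->
  (forall k, has_cyl k (lhs e) || has_cyl k (rhs e) ->
     lines_full K pi col k) ->
  (forall l m, has_diag l m (lhs e) || has_diag l m (rhs e) ->
     injective pi) ->
  forall s c s',
    (forall Y, K Y -> Y s c <-> Y (pi \o s') (col s')) ->
  teval v (lhs e) s c <-> teval v (rhs e) s c.
Proof.
move=> He Kcl Kv Hswap Hcyl Hdiag s c s' ss'.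
have Kl x : x \in tvars (lhs e) -> K (v x).
  by move=> xl; apply: Kv; rewrite mem_cat xl.
have Kr x : x \in tvars (rhs e) -> K (v x).
  by move=> xr; apply: Kv; rewrite mem_cat xr orbT.
rewrite ss'; last exact: teval_closed.
rewrite [in X in _ <-> X]ss'; last exact: teval_closed.
rewrite -!(@teval_coloured _ _ _ _ K) //.
- by rewrite He.
- by move=> i j ij; apply: (Hswap i j); rewrite ij orbT.
- by move=> k Hk; apply: Hcyl; rewrite Hk orbT.
- by move=> l m lm; apply: (Hdiag l m); rewrite lm orbT.
- by move=> i j ij; apply: (Hswap i j); rewrite ij.
- by move=> k Hk; apply: Hcyl; rewrite Hk.
- by move=> l m lm; apply: (Hdiag l m); rewrite lm.
Qed.

(** * The split algebra *)

(** The base of the split algebra.  The labellings are all the bijections from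
    vertices to labels; having all of them keeps every two vertices
    indistinguishable in spite of the labels. *)
Inductive node (N : nat) : Type :=
| Vertex of 'I_N.+1
| Labelling of {perm 'I_N.+1}
| Filler of nat.

Arguments Filler {N} _.

Definition is_vertex N (u : node N) : bool :=
  if u is Vertex _ then true else false.

Definition is_labelling N (u : node N) : bool :=
  if u is Labelling _ then true else false.

Definition labels N (f u : node N) (i : 'I_N.+1) : bool :=
  match f, u with
  | Labelling f, Vertex x => f x == i
  | _, _ => false
  end.

Definition automorphism N (g : node N -> node N) : Prop :=
  [/\ bijective g, forall u, is_vertex (g u) = is_vertex u,
      forall u, is_labelling (g u) = is_labelling u
    & forall f u i, labels (g f) (g u) i = labels f u i].

Lemma automorphism_comp N (g h : node N -> node N) :
  automorphism g -> automorphism h -> automorphism (g \o h).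
Proof.
move=> [gb gv gl gn] [hb hv hl hn]; split.
- exact: bij_comp.
- by move=> u /=; rewrite gv hv.
- by move=> u /=; rewrite gl hl.
- by move=> f u i /=; rewrite gn hn.
Qed.

(** When two vertices are exchanged, each labelling has to be composed with the
    transposition; when two fillers are, no labelling has to move. *)
Lemma exists_exchange N (a b : node N) :
  is_vertex a = is_vertex b -> ~~ is_labelling a -> ~~ is_labelling b ->
  exists g, [/\ automorphism g, g a = b
    & forall u, ~~ is_labelling u -> u <> a -> u <> b -> g u = u].
Proof.
case: a => [x|f|c]; case: b => [y|f'|d] // _ _ _.
- pose g (u : node N) := match u with
    | Vertex z => Vertex (tperm x y z)
    | Labelling f => Labelling (tperm x y * f)
    | Filler c => Filler c end.
  have gK : involutive g.
    by case=> [z|f|c] //=; rewrite ?tpermK // mulgA tperm2 mul1g.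
  exists g; split.
  + split; first exact: inv_bij.
    * by case.
    * by case.
    * by case=> [z|f|c] [z'|f'|c'] i //=; rewrite permM tpermK.
  + by rewrite /= tpermL.
  + by case=> [z|f|c] //= _ zx zy; rewrite tpermD //; apply/eqP => E;
      [apply: zx|apply: zy]; rewrite E.
- pose g (u : node N) :=
    if u is Filler e then
      Filler (if e == c then d else if e == d then c else e) else u.
  have gK : involutive g.
    by case=> [z|f|e] //=; congr Filler; do !case: eqP => //; congruence.
  exists g; split.
  + split; first exact: inv_bij.
    * by case.
    * by case.
    * by case=> [z|f|e] [z'|f'|e'] i.
  + by rewrite /= eqxx.
  + case=> [z|f|e] //= _ ec ed; congr Filler.
    case: eqP => [E|_]; first by case: ec; rewrite E.
    by case: eqP => // E; case: ed; rewrite E.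
Qed.

Definition vertex_set al N (s : 'I_al -> node N) : {set 'I_al} :=
  [set j | is_vertex (s j)].

(** The partial map from [s] to [s'] is extended one coordinate at a time by
    composing with exchanges, which leave the earlier coordinates alone. *)
Lemma automorphism_homogeneous al N (s s' : 'I_al -> node N) :
  injective s -> injective s' ->
  (forall j, ~~ is_labelling (s j)) -> (forall j, ~~ is_labelling (s' j)) ->
  vertex_set s = vertex_set s' ->
  exists2 g, automorphism g & g \o s = s'.
Proof.
move=> s_inj s'_inj s_nl s'_nl svs'.
suff /(_ al) [g gA gs] : forall m, exists2 g : node N -> node N,
    automorphism g & forall l : 'I_al, l < m -> g (s l) = s' l.
  by exists g => //; apply: funext => l; apply: gs.
elim=> [|m [g gA gs]].
  by exists id => //; split=> //; exists id.
case: (ltnP m al) => [mal|alm]; last first.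
  exists g => // l _; apply: gs; exact: leq_trans (ltn_ord l) alm.
have [gb gv gl gn] := gA; pose k := Ordinal mal.
have [||| h [hA hk hfix]] := @exists_exchange N (g (s k)) (s' k).
- rewrite gv; have /setP/(_ k) := svs'; by rewrite !inE.
- by rewrite gl.
- by [].
exists (h \o g); first exact: automorphism_comp.
move=> l; rewrite ltnS leq_eqVlt => /predU1P[lm|lm] /=.
  by have -> : l = k by apply: val_inj.
have lk : l <> k by move=> /(congr1 val) /= E; rewrite E ltnn in lm.
rewrite gs // hfix //; last by move/s'_inj.
by rewrite -gs // => /(bij_inj gb)/s_inj.
Qed.

(** Two vertices, not more: the line through a generic sequence in the direction
    of a vertex then has exactly [N] generic points, one for each colour. *)
Definition generic al N (s : 'I_al -> node N) : Prop :=
  [/\ injective s, forall j, ~~ is_labelling (s j) & #|vertex_set s| = 2].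

Lemma generic_tperm al N (s : 'I_al -> node N) i j :
  generic (s \o tperm i j) <-> generic s.
Proof.
have H (u : 'I_al -> node N) : generic u -> generic (u \o tperm i j).
  move=> [u_inj u_nl u2]; split.
  - by apply: inj_comp => //; apply: perm_inj.
  - by move=> l /=.
  - rewrite -u2 -(card_imset _ (@perm_inj _ (tperm i j))).
    apply: eq_card => l; rewrite inE; apply/imsetP/idP => [[m mu ->]|lu].
      by move: mu; rewrite inE.
    by exists (tperm i j l); rewrite ?tpermK // inE /= tpermK.
split=> [/H|/H //].
by congr generic; apply: funext => l /=; rewrite tpermK.
Qed.

Lemma generic_automorphism al N g (s : 'I_al -> node N) :
  automorphism g -> generic (g \o s) <-> generic s.
Proof.
move=> [gb gv gl _].
have vE : vertex_set (g \o s) = vertex_set s.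
  by apply/setP => j; rewrite !inE /= gv.
split=> -[s_inj s_nl s2]; split.
- by move=> i j sij; apply: s_inj; rewrite /= sij.
- by move=> j; rewrite -gl; apply: s_nl.
- by rewrite -vE.
- by apply: inj_comp => //; apply: bij_inj.
- by move=> j; rewrite /= gl.
- by rewrite vE.
Qed.

(** For [sig := id] these are the elements of the split algebra.  A general
    [sig] describes the subalgebra in which colours with the same signature
    are merged. *)
Definition admissible al N (S : Type) (sig : 'I_N -> S)
    (Y : calg al (node N) 'I_N) : Prop :=
  (forall s c d, (generic s -> sig c = sig d) -> Y s c -> Y s d) /\
  (forall g s c, automorphism g -> Y (g \o s) c <-> Y s c).

Lemma admissible_closed al N S (sig : 'I_N -> S) :
  closed_under_ops (@admissible al N S sig).
Proof.
split.
- move=> Y Z [Yc Ya] [Zc Za]; split=> [s c d cd|g s c gA] /=.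
    by move=> [/(Yc _ _ _ cd)|/(Zc _ _ _ cd)]; [left|right].
  by rewrite Ya ?Za.
- move=> Y [Yc Ya]; split=> [s c d cd NY /= Yd|g s c gA] /=.
    by apply/NY/(Yc s d c) => // sG; rewrite cd.
  by rewrite Ya.
- move=> k Y [Yc Ya]; split=> // g s c gA /=.
  have [[h gK hK] _ _ _] := gA.
  split=> -[a [d H]]; last by exists (g a), d; rewrite -comp_upd Ya.
  by exists (h a), d; move: H; rewrite -{1}(hK a) -comp_upd Ya.
- move=> i j; split=> // g s c [gb _ _ _] /=.
  by split=> [/(bij_inj gb)|->].
- move=> i j Y [Yc Ya]; split=> [s c d cd|g s c gA] /=.
    by apply: Yc => /generic_tperm.
  exact: (Ya g (s \o tperm i j)).
Qed.

(** By homogeneity an automorphism moves [s] to [s']. *)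
Lemma admissible_generic al N S (sig : 'I_N -> S) Y
    (s s' : 'I_al -> node N) c d :
  admissible sig Y -> generic s -> generic s' ->
  vertex_set s = vertex_set s' -> sig c = sig d -> Y s c -> Y s' d.
Proof.
move=> [Yc Ya] [si sl _] s'G ss' cd.
have [s'i s'l _] := s'G.
have [g gA <-] := automorphism_homogeneous si s'i sl s'l ss'.
by move=> Ysc; apply/(Ya g) => //; apply: (Yc s c d).
Qed.

(** * Colourings that meet every colour on every line *)

(** One condition serves two purposes: it makes the induced map commute with
    cylindrifications ([rich_lines_full]) and makes it injective
    ([rich_cover]). *)
Definition rich_colouring al N S (sig : 'I_N -> S)
    (col : ('I_al -> node N) -> 'I_N) : Prop :=
  forall s j c, generic s -> exists a,
    [/\ generic (upd s j a), vertex_set (upd s j a) = vertex_set s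
      & sig (col (upd s j a)) = sig c].

Lemma upd_upd al M (s : 'I_al -> M) k a b :
  upd (upd s k a) k b = upd s k b.
Proof. by apply: funext => j; rewrite /upd; case: eqP. Qed.

Lemma rich_lines_full al N S (sig : 'I_N -> S) col k :
  rich_colouring sig col ->
  lines_full (@admissible al N S sig) id col k.
Proof.
move=> rich s a c.
have [sG|sNG] := pselect (generic (upd s k a)); last first.
  by exists a => Y [Yc Ya]; apply: Yc => /sNG.
have [b [bG bv bc]] := rich _ k c sG.
rewrite upd_upd in bG bv bc; exists b => Y YA.
exact: admissible_generic YA sG bG (esym bv) (esym bc).
Qed.

Lemma rich_cover al N S (sig : 'I_N -> S) (col : ('I_al -> node N) -> 'I_N)
    s c : 0 < al -> rich_colouring sig col ->
  exists s', forall Y, admissible sig Y -> Y s c <-> Y s' (col s').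
Proof.
move=> al_gt0 rich.
have [sG|sNG] := pselect (generic s); last first.
  by exists s => Y [Yc Ya]; split; apply: Yc.
have [a [aG av ac]] := rich s (Ordinal al_gt0) c sG.
exists (upd s (Ordinal al_gt0) a) => Y YA; split.
  exact: admissible_generic YA sG aG (esym av) (esym ac).
exact: admissible_generic YA aG sG av ac.
Qed.

Lemma generic_upd al N (s : 'I_al -> node N) j a :
  generic s -> is_vertex a = is_vertex (s j) -> ~~ is_labelling a ->
  (forall l, l != j -> s l <> a) ->
  generic (upd s j a) /\ vertex_set (upd s j a) = vertex_set s.
Proof.
move=> [s_inj s_nl s2] av al' sa.
have vE : vertex_set (upd s j a) = vertex_set s.
  by apply/setP => l; rewrite !inE /upd; case: eqP => [->|].
split=> //; split; last by rewrite vE.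
- move=> k l; rewrite /upd.
  case: (eqVneq k j) (eqVneq l j) => [->|kj] [->|lj] //.
  + by move=> E; case: (sa l).
  + by move=> E; case: (sa k).
  + exact: s_inj.
- by move=> l; rewrite /upd; case: eqP.
Qed.

Lemma generic_mate al N (s : 'I_al -> node N) j :
  generic s -> is_vertex (s j) ->
  exists p x, [/\ p != j, s p = Vertex x & vertex_set s = [set j; p]%SET].
Proof.
move=> [s_inj s_nl s2] sj.
have jv : j \in vertex_set s by rewrite inE.
have /eqP/cards1P[p sp] : #|vertex_set s :\ j| = 1.
  by move: s2; rewrite (cardsD1 j) jv => -[].
have : p \in vertex_set s :\ j by rewrite sp set11.
rewrite !inE => /andP[pj]; case sp': (s p) => [x|//|//] _.
exists p, x; split=> //; by rewrite -(finset.setD1K jv) sp.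
Qed.

Lemma modn_complete R S i : i < R -> exists2 t, t < R & (S + t) %% R = i.
Proof.
move=> iR; have R_gt0 : 0 < R by apply: leq_ltn_trans iR.
exists ((i + (R - S %% R)) %% R); first exact: ltn_pmod.
rewrite modnDmr addnCA; set d := R - _.
have -> : S + d = (S %/ R).+1 * R.
  by rewrite {1}(divn_eq S R) mulSn -addnA subnKC 1?addnC // ltnW // ltn_pmod.
by rewrite addnC modnMDl modn_small.
Qed.

Lemma sum_upd al M (f : M -> nat) (s : 'I_al -> M) j a :
  \sum_l f (upd s j a l) = \sum_(l | l != j) f (s l) + f a.
Proof.
rewrite (bigD1 j) //= addnC /upd eqxx; congr (_ + _).
by apply: eq_bigr => l /negPf ->.
Qed.

Lemma sum_tperm al M (f : M -> nat) (s : 'I_al -> M) i j :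
  \sum_l f ((s \o tperm i j) l) = \sum_l f (s l).
Proof. by rewrite [RHS](reindex_inj (@perm_inj _ (tperm i j))). Qed.

Definition filler_value N (u : node N) : nat :=
  if u is Filler c then c else 0.

Definition value N (u : node N) : nat :=
  match u with Vertex x => x | Filler c => c | Labelling _ => 0 end.

(** A filler beyond the sum of the fillers present is fresh. *)
Lemma generic_upd_filler al N (s : 'I_al -> node N) j c :
  generic s -> ~~ is_vertex (s j) -> \sum_l filler_value (s l) < c ->
  generic (upd s j (Filler c)) /\
  vertex_set (upd s j (Filler c)) = vertex_set s.
Proof.
move=> sG sj sc; apply: generic_upd => //; first by rewrite (negPf sj).
move=> l lj E; move: sc; rewrite (bigD1 l) //= E /=.
by rewrite ltnNge leq_addr.
Qed.

Definition symmetric_colouring al N R (rep : nat -> 'I_N)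
    (s : 'I_al -> node N) : 'I_N := rep ((\sum_l value (s l)) %% R).

(** A target residue is attained by two different vertices because the vertices
    are [0, ..., N] with [2 * R <= N]; one of them is not the mate. *)
Lemma symmetric_colouring_rich al N R S (sig : 'I_N -> S) rep :
  2 * R <= N -> (forall c, exists2 m, m < R & sig (rep m) = sig c) ->
  rich_colouring sig (@symmetric_colouring al N R rep).
Proof.
move=> RN repP s j c sG; have [m mR <-] := repP c.
have [t tR tm] := modn_complete (\sum_(l | l != j) value (s l)) mR.
have [sj|sj] := boolP (is_vertex (s j)); last first.
  (* large enough to be fresh, with the residue of [t] *)
  pose c' := t + R * (\sum_l filler_value (s l)).+1.
  have [|G V] := @generic_upd_filler al N s j c' sG sj.
    by rewrite /c'; nia.
  exists (Filler c'); split=> //; rewrite /symmetric_colouring sum_upd /=.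
  by rewrite addnA addnC mulnC modnMDl tm.
have [p [x [pj sp sv]]] := generic_mate sG sj.
have [y yx yt] : exists2 y : 'I_N.+1, y != x & y = t %[mod R].
  have tN : t < N.+1 by lia.
  have tRN : t + R < N.+1 by lia.
  have [tx|] := eqVneq (Ordinal tN) x; last by exists (Ordinal tN).
  exists (Ordinal tRN); last by rewrite /= modnDr.
  apply/eqP => E; have := congr1 val E; rewrite -tx /=; lia.
have [|||G V] := @generic_upd al N s j (Vertex y) sG.
- by rewrite sj.
- by [].
- move=> l lj sl; have : l \in vertex_set s by rewrite inE sl.
  rewrite sv !inE (negPf lj) => /eqP lp; move: sl; rewrite lp sp => -[xy].
  by rewrite xy eqxx in yx.
exists (Vertex y); split=> //; rewrite /symmetric_colouring sum_upd /=.
by rewrite -modnDmr yt modnDmr tm.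
Qed.

Lemma symmetric_colouring_tperm al N R rep (s : 'I_al -> node N) i j :
  symmetric_colouring R rep (s \o tperm i j) = symmetric_colouring R rep s.
Proof. by rewrite /symmetric_colouring sum_tperm. Qed.

(** The difference in [Z/(N+1)], shifted so that distinct vertices have the
    distances [0, ..., N-1]. *)
Definition distance N (u w : node N) : nat :=
  match u, w with
  | Vertex x, Vertex y => (nat_of_ord (y - x)%R).-1
  | _, _ => 0
  end.

(** The two vertices are taken in the order of their coordinates; this is what
    makes the resulting colouring incompatible with transpositions. *)
Definition ordered_distance al N (s : 'I_al -> node N) : nat :=
  if [pick pq : 'I_al * 'I_al |
        [&& pq.1 < pq.2, is_vertex (s pq.1) & is_vertex (s pq.2)]]
    is Some (p, q) then distance (s p) (s q) else 0.

(** The coordinates that [pick] selects depend on the vertex set only, hence do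
    not change along a line. *)
Lemma ordered_distanceE al N (s : 'I_al -> node N) : generic s ->
  exists p q : 'I_al, [/\ p < q, vertex_set s = [set p; q]%SET
    & forall s' : 'I_al -> node N, vertex_set s' = vertex_set s ->
        ordered_distance s' = distance (s' p) (s' q)].
Proof.
move=> [s_inj s_nl /eqP/cards2P[p [q [pq sv]]]].
pose P (u : 'I_al -> node N) (pq : 'I_al * 'I_al) :=
  [&& pq.1 < pq.2, is_vertex (u pq.1) & is_vertex (u pq.2)].
have PE s' : vertex_set s' = vertex_set s -> P s' =1 P s.
  move=> /setP E -[i j]; rewrite /P /=.
  by have := (E i, E j); rewrite !inE => -[-> ->].
have Pin i j : P s (i, j) = [&& i < j, i \in [set p; q]%SET
                                   & j \in [set p; q]%SET].
  by rewrite -sv !inE.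
have [[i j] Pij|P0] := pickP (P s); last first.
  have := (P0 (p, q), P0 (q, p)); rewrite !Pin !inE !eqxx !orbT !andbT => -[].
  by move: pq; rewrite neq_ltn => /orP[->|->].
have [[i' j'] pickE Pij'] : exists2 ij, [pick x | P s x] = Some ij & P s ij.
  case: pickP => [ij Psij|/(_ (i, j))]; first by exists ij.
  by rewrite Pij.
exists i', j'; split.
- by have /and3P[] := Pij'.
- have := Pij'; rewrite Pin sv => /and3P[ij]; rewrite !inE.
  move=> /orP[]/eqP E1 /orP[]/eqP E2; subst; rewrite ?ltnn // in ij *.
  by rewrite finset.setUC.
- move=> s' s's; rewrite /ordered_distance.
  by rewrite -/(P s' _) (eq_pick (PE _ s's)) pickE.
Qed.

Definition skew_colouring al N (N_gt0 : 0 < N) (s : 'I_al -> node N) : 'I_N :=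
  Ordinal (ltn_pmod (\sum_l filler_value (s l) + ordered_distance s) N_gt0).

Lemma distance_surj N (x : 'I_N.+1) t : t < N ->
  exists y z, [/\ y != x, z != x, distance (Vertex x) (Vertex y) = t
    & distance (Vertex z) (Vertex x) = t].
Proof.
move=> tN; pose d : 'I_N.+1 := inord t.+1.
have dE : d = t.+1 :> nat by rewrite /d inordK.
have d0 : d != 0%R.
  by apply/eqP => E; have := congr1 (@nat_of_ord _) E; rewrite dE.
exists (x + d)%R, (x - d)%R; split.
- by rewrite -subr_eq0 addrC addKr.
- by rewrite -subr_eq0 addrC addKr oppr_eq0.
- by rewrite /distance [(_ + d)%R]addrC addrK dE.
- by rewrite /distance opprD opprK addrA subrr add0r dE.
Qed.

(** In the direction of a vertex only the difference varies, and it takes each of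
    its [N] values once.  In the direction of a filler the difference is
    constant, and fresh fillers with any residue modulo [N] are available. *)
Lemma skew_colouring_rich al N (N_gt0 : 0 < N) :
  rich_colouring id (@skew_colouring al N N_gt0).
Proof.
move=> s j c sG.
have [p [q [pq sv sE]]] := ordered_distanceE sG.
have [sj|sj] := boolP (is_vertex (s j)); last first.
  have [t tN tc] := modn_complete
    (\sum_(l | l != j) filler_value (s l) + ordered_distance s) (ltn_ord c).
  pose c' := t + N * (\sum_l filler_value (s l)).+1.
  have [|G V] := @generic_upd_filler al N s j c' sG sj.
    by rewrite /c'; nia.
  exists (Filler c'); split=> //; apply: val_inj; rewrite /= sum_upd /=.
  have out l : l \in [set p; q]%SET -> upd s j (Filler c') l = s l.
    rewrite -sv inE /upd => sl; case: eqP => // lj.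
    by rewrite -lj sl in sj.
  rewrite (sE _ V) !out ?inE ?eqxx ?orbT // -(sE _ (erefl _)).
  by rewrite addnAC /c' addnA addnC mulnC modnMDl tc.
have [t tN tc] := modn_complete (\sum_(l | l != j) filler_value (s l))
  (ltn_ord c).
have [m [x [mj sm sv']]] := generic_mate sG sj.
have [y [z [yx zx dy dz]]] := distance_surj x tN.
have good w : w != x ->
    distance (upd s j (Vertex w) p) (upd s j (Vertex w) q) = t ->
    exists a, [/\ generic (upd s j a), vertex_set (upd s j a) = vertex_set s
      & skew_colouring N_gt0 (upd s j a) = c].
  move=> wx dw.
  have [|||G V] := @generic_upd al N s j (Vertex w) sG.
  - by rewrite sj.
  - by [].
  - move=> l lj sl; have : l \in vertex_set s by rewrite inE sl.
    rewrite sv' !inE (negPf lj) => /eqP lm; move: sl; rewrite lm sm => -[xw].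
    by rewrite xw eqxx in wx.
  exists (Vertex w); split=> //; apply: val_inj; rewrite /= sum_upd /= addn0.
  by rewrite (sE _ V) dw.
have : j \in [set p; q]%SET by rewrite -sv inE.
have mpq : m \in [set p; q]%SET by rewrite -sv sv' !inE eqxx orbT.
rewrite !inE in mpq *; case/orP => /eqP jE; subst j.
- have mq : m = q by move: mpq; rewrite (negPf mj) => /eqP.
  subst m; apply: (good z) => //.
  by rewrite /upd eqxx (negPf mj) sm.
- have mp : m = p by move: mpq; rewrite (negPf mj) orbF => /eqP.
  subst m; apply: (good y) => //.
  by rewrite /upd eqxx (negPf mj) sm.
Qed.

(** Moving to another copy of the same point of [U] changes the colour at
    will, in any direction. *)
Definition blowup_colouring al U N (N_gt0 : 0 < N)
    (s : 'I_al -> U * nat) : 'I_N :=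
  Ordinal (ltn_pmod (\sum_l (s l).2) N_gt0).

Lemma blowup_colouring_tperm al U N (N_gt0 : 0 < N) (s : 'I_al -> U * nat) i j :
  blowup_colouring N_gt0 (s \o tperm i j) = blowup_colouring N_gt0 s.
Proof.
by apply: val_inj; rewrite /= (sum_tperm (fun u => u.2) s i j).
Qed.

Lemma blowup_colouring_upd al U N (N_gt0 : 0 < N) (s : 'I_al -> U * nat) k a c :
  exists t, blowup_colouring N_gt0 (upd s k (a, t)) = c.
Proof.
have [t tN tc] := modn_complete (\sum_(l | l != k) (s l).2) (ltn_ord c).
exists t; apply: val_inj; by rewrite /= (sum_upd (fun u => u.2)) /= tc.
Qed.

Lemma blowup_lines_full al U N (N_gt0 : 0 < N) (K : calg al U 'I_N -> Prop) k :
  lines_full K fst (blowup_colouring N_gt0) k.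
Proof.
move=> s a c; have [t tc] := blowup_colouring_upd N_gt0 s k a c.
by exists (a, t) => Y _; rewrite comp_upd tc.
Qed.

(** * The equation that fails *)

(** The points moved upwards and the points moved downwards are in bijection. *)
Lemma fixfree_involution_even n (f : 'I_n -> 'I_n) :
  involutive f -> (forall x, f x != x) -> ~~ odd n.
Proof.
move=> fK fx; pose B := [set x : 'I_n | x < f x]%SET.
have BC : ~: B = f @: B.
  apply/setP => x; rewrite !inE; apply/idP/imsetP => [xfx|[y yB ->]].
    exists (f x); rewrite ?fK // inE fK; move: xfx.
    by case: ltngtP => // /val_inj E; have := fx x; rewrite -E eqxx.
  by move: yB; rewrite inE fK -leqNgt => /ltnW.
have := cardsC B; rewrite BC card_imset; last exact: inv_inj.
by rewrite card_ord addnn => <-; rewrite odd_double.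
Qed.

(** Label the vertices injectively by [Q].  A vertex and its [N] neighbours, one
    in each relation, use up all the [N.+1] labels.  So each relation is the
    graph of an involution without fixed points on an odd number of labels. *)
Lemma no_even_factorization N M (R : 'I_N -> M -> M -> Prop)
    (Q : 'I_N.+1 -> M -> Prop) :
  ~~ odd N ->
  (forall i x y, R i x y -> R i y x) ->
  (forall i j x y, R j x y -> exists y', R i x y') ->
  (forall i j x y, R i x y -> R j x y -> i = j) ->
  (forall i x, ~ R i x x) ->
  (forall i x y, R i x y -> exists q, Q q x) ->
  (forall q x y, Q q x -> Q q y -> x = y) ->
  forall i x y, ~ R i x y.
Proof.
move=> Nev Rsym Rtot Rdisj Rirr Rlab Qinj o x0 y0 Rx0.
pose D x := exists i y, R i x y.
have [lab labP] : {lab : M -> 'I_N.+1 & forall x, D x -> Q (lab x) x}.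
  apply: (choice (P := fun x q => D x -> Q q x)) => x.
  have [[i [y /Rlab[q Qq]]]|ND] := pselect (D x).
    by exists q.
  by exists ord0.
have [nb nbP] : {nb : M * 'I_N -> M & forall xi,
    D xi.1 -> R xi.2 xi.1 (nb xi)}.
  apply: (choice (P := fun xi y => D xi.1 -> R xi.2 xi.1 y)) => -[x i] /=.
  have [[j [y /(Rtot i)[y' Rxy']]]|ND] := pselect (D x).
    by exists y'.
  by exists x.
have lab_inj x y : D x -> D y -> lab x = lab y -> x = y.
  by move=> /labP Qx /labP Qy E; apply: (Qinj (lab x)); rewrite // E.
have nbD x i : D x -> D (nb (x, i)).
  by move=> Dx; exists i, x; apply/Rsym/(nbP (x, i)).
have labS x q : D x -> exists2 y, lab y = q & y = x \/ exists i, y = nb (x, i).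
  move=> Dx.
  pose h (j : option 'I_N) := if j is Some i then lab (nb (x, i)) else lab x.
  have h_inj : injective h.
    have hx i : lab (nb (x, i)) <> lab x.
      move=> /lab_inj E; apply: (Rirr i x); rewrite -{2}E //; last exact: nbD.
      exact: (nbP (x, i)).
    case=> [i|] [j|] //= E; last 2 first.
    - by case: (hx i).
    - by case: (hx j).
    congr Some; apply: (Rdisj i j x (nb (x, i))); first exact: (nbP (x, i)).
    by rewrite (lab_inj _ _ (nbD x i Dx) (nbD x j Dx) E); apply: (nbP (x, j)).
  have [g _ gK] : bijective h.
    by apply: inj_card_bij => //; rewrite card_option !card_ord.
  rewrite -(gK q); case: (g q) => [i|] /=; last by exists x; [|left].
  by exists (nb (x, i)); [|right; exists i].
have D0 : D x0 by exists o, y0.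
have [unlab unlabP] : {unlab : 'I_N.+1 -> M & forall q,
    D (unlab q) /\ lab (unlab q) = q}.
  apply: (choice (P := fun q x => D x /\ lab x = q)) => q.
  have [y <- [->|[i ->]]] := labS x0 q D0.
    by exists x0.
  by exists (nb (x0, i)); split=> //; apply: nbD.
have unlabK x : D x -> unlab (lab x) = x.
  by move=> Dx; have [Di Li] := unlabP (lab x); apply: lab_inj.
have Runiq x y : D x -> R o x y -> y = nb (x, o).
  move=> Dx Rxy; have Dy : D y by exists o, x; apply: Rsym.
  have [z zy [zx|[i zi]]] := labS x (lab y) Dx.
    have xy : x = y by apply: lab_inj => //; rewrite -zx.
    by move: Rxy; rewrite xy => /Rirr.
  have yi : y = nb (x, i) by apply: lab_inj => //; [apply: nbD|rewrite -zi zy].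
  by rewrite {1}yi; congr (nb (_, _)); apply: (Rdisj i o x y) => //; rewrite yi;
    apply: (nbP (x, i)).
suff : ~~ odd N.+1 by rewrite /= Nev.
apply: (@fixfree_involution_even _ (fun q => lab (nb (unlab q, o)))).
- move=> q; have [Dq Lq] := unlabP q; rewrite unlabK; last exact: nbD.
  rewrite -(Runiq (nb (unlab q, o)) (unlab q)) //; first exact: nbD.
  exact/Rsym/(nbP (unlab q, o)).
- move=> q; have [Dq Lq] := unlabP q; apply/eqP => E.
  apply: (Rirr o (unlab q)); have := nbP (unlab q, o) Dq.
  by rewrite /= -[X in R _ _ X]unlabK ?E //; apply: nbD.
Qed.

Section Equation.
Variables (al : nat) (i0 : 'I_al).

Definition tmul (t u : term al) := TNeg (TAdd (TNeg t) (TNeg u)).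
Definition timp (t u : term al) := TAdd (TNeg t) u.
Definition tall i (t : term al) := TNeg (TCyl i (TNeg t)).
Definition tbigmul N (f : nat -> term al) :=
  foldr (fun i => tmul (f i)) (TDiag i0 i0) (iota 0 N).
Definition tbigadd N (f : nat -> term al) :=
  foldr (fun i => @TAdd al (f i)) (TNeg (TDiag i0 i0)) (iota 0 N).

Variables (M C : Type).
Implicit Types (v : nat -> calg al M C) (s : 'I_al -> M) (c : C).

Lemma teval_neg v t s c : teval v (TNeg t) s c <-> ~ teval v t s c.
Proof. by []. Qed.

Lemma teval_cyl v i t s c :
  teval v (TCyl i t) s c <-> exists a d, teval v t (upd s i a) d.
Proof. by []. Qed.

Lemma teval_mul v t u s c :
  teval v (tmul t u) s c <-> teval v t s c /\ teval v u s c.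
Proof. by rewrite /= not_orE !notK. Qed.

Lemma teval_imp v t u s c :
  teval v (timp t u) s c <-> (teval v t s c -> teval v u s c).
Proof. by rewrite /= implyE. Qed.

Lemma teval_all v i t s c :
  teval v (tall i t) s c <-> forall a d, teval v t (upd s i a) d.
Proof.
split=> /= [H a d|H [a [d]]]; last by apply.
by apply: contrapT => N; apply: H; exists a, d.
Qed.

Lemma teval_bigmul v N f s c :
  teval v (tbigmul N f) s c <-> forall i, i < N -> teval v (f i) s c.
Proof.
rewrite /tbigmul.
suff H l : teval v (foldr (fun i => tmul (f i)) (TDiag i0 i0) l) s c
    <-> forall i, i \in l -> teval v (f i) s c.
  by rewrite H; split=> K i iN; apply: K; rewrite mem_iota add0n in iN *.
elim: l => [|j l IHl]; first by split.
rewrite [foldr _ _ _]/= teval_mul IHl; split=> [[fj fl] i|K].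
  by rewrite inE => /predU1P[->|/fl].
by split=> [|i il]; apply: K; rewrite inE ?eqxx // il orbT.
Qed.

Lemma teval_bigadd v N f s c :
  teval v (tbigadd N f) s c <-> exists2 i, i < N & teval v (f i) s c.
Proof.
rewrite /tbigadd.
suff H l :
    teval v (foldr (fun i => @TAdd al (f i)) (TNeg (TDiag i0 i0)) l) s c <->
    exists2 i, i \in l & teval v (f i) s c.
  rewrite H; split=> -[i iN fi]; exists i => //;
    by rewrite mem_iota add0n in iN *.
elim: l => [|j l IHl] /=; first by split=> [|[]].
rewrite IHl; split=> [[fj|[i il fi]]|[i]].
- by exists j; rewrite ?inE ?eqxx.
- by exists i; rewrite // inE il orbT.
- by rewrite inE => /predU1P[->|il fi]; [left|right; exists i].
Qed.

End Equation.

Section Factorization.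
Variables (al : nat) (i0 i1 i2 : 'I_al) (N : nat).

Definition colour_class i : term al := TVar i.
Definition label_class q : term al := TCyl i1 (TVar (N + q)).

(** The hypotheses of [no_even_factorization], for relations between the
    coordinates [i0] and [i1]: the colour classes factorize a complete graph.
    The labels are read off with [i2] at a suitable value; that value is the
    same for all vertices because [i2] is quantified before [i0].  Labels are
    cylindrified along [i1] so that interchanging [i0] and [i1] yields the
    label of the point at [i1]. *)
Definition factorization : term al :=
  tmul (tbigmul i0 N (fun i =>
          timp (colour_class i) (TSwap i0 i1 (colour_class i))))
  (tmul (tbigmul i0 N (fun i => tbigmul i0 N (fun j =>
          timp (colour_class j) (TCyl i1 (colour_class i)))))
  (tmul (tbigmul i0 N (fun i => tbigmul i0 N (fun j =>
          if i == j then TDiag i0 i0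
          else TNeg (tmul (colour_class i) (colour_class j)))))
  (tmul (tbigmul i0 N (fun i =>
          TNeg (tmul (colour_class i) (TDiag i0 i1))))
  (tmul (tbigmul i0 N.+1 (fun q =>
          timp (tmul (label_class q) (TSwap i0 i1 (label_class q)))
               (TDiag i0 i1)))
    (TCyl i2 (tall i0
      (timp (TCyl i1 (TCyl i2 (tbigadd i0 N colour_class)))
            (tbigadd i0 N.+1 label_class)))))))).

(** Cylindrifying a failure of [factorization] turns the implication from
    [factorization] everywhere to emptiness into an equation.  Three of the
    coordinates suffice, since the others are mere parameters. *)
Definition factorization_equation : equation al :=
  Eqn (tmul (colour_class 0) (tall i0 (tall i1 (tall i2 factorization))))
      (TNeg (TDiag i0 i0)).

Lemma teval_factorization M C (v : nat -> calg al M C) s c :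
  let L q s := exists b d, v (N + q) (upd s i1 b) d in
  teval v factorization s c <->
  (forall i, i < N -> v i s c -> v i (s \o tperm i0 i1) c) /\
  (forall i, i < N -> forall j, j < N -> v j s c ->
     exists y d, v i (upd s i1 y) d) /\
  (forall i, i < N -> forall j, j < N -> v i s c -> v j s c -> i = j) /\
  (forall i, i < N -> v i s c -> s i0 <> s i1) /\
  (forall q, q < N.+1 -> L q s -> L q (s \o tperm i0 i1) -> s i0 = s i1) /\
  (exists f (_ : C), forall a (_ : C),
     let s' := upd (upd s i2 f) i0 a in
     (exists y (_ : C) u d',
        exists2 i, i < N & v i (upd (upd s' i1 y) i2 u) d') ->
     exists2 q, q < N.+1 & L q s').
Proof.
move=> L; rewrite /factorization 5!teval_mul 5!teval_bigmul.
have E1 : (forall i, i < N ->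
    teval v (timp (colour_class i) (TSwap i0 i1 (colour_class i))) s c)
  <-> (forall i, i < N -> v i s c -> v i (s \o tperm i0 i1) c).
  by split=> H i iN; have := H i iN; rewrite teval_imp.
have E2 : (forall i, i < N -> teval v (tbigmul i0 N (fun j =>
          timp (colour_class j) (TCyl i1 (colour_class i)))) s c)
  <-> (forall i, i < N -> forall j, j < N -> v j s c ->
     exists y d, v i (upd s i1 y) d).
  split=> H i iN; have := H i iN; rewrite teval_bigmul => H' j jN;
    by have := H' j jN; rewrite teval_imp.
have E3 : (forall i, i < N -> teval v (tbigmul i0 N (fun j =>
        if i == j then TDiag i0 i0
          else TNeg (tmul (colour_class i) (colour_class j)))) s c)
  <-> (forall i, i < N -> forall j, j < N -> v i s c -> v j s c -> i = j).
  split=> H i iN; have := H i iN; rewrite teval_bigmul => H' j jN.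
    have := H' j jN; case: eqP => // ij; rewrite teval_neg teval_mul.
    by move=> nij vi vj; case: nij.
  case: eqP => // ij; rewrite teval_neg teval_mul => -[vi vj].
  exact/ij/H'.
have E4 : (forall i, i < N ->
    teval v (TNeg (tmul (colour_class i) (TDiag i0 i1))) s c)
  <-> (forall i, i < N -> v i s c -> s i0 <> s i1).
  split=> H i iN; have Hi := H i iN.
    by rewrite teval_neg teval_mul in Hi; move=> vi E; apply: Hi.
  by rewrite teval_neg teval_mul => -[/Hi].
have E5 : (forall q, q < N.+1 ->
    teval v (timp (tmul (label_class q) (TSwap i0 i1 (label_class q)))
               (TDiag i0 i1)) s c)
  <-> (forall q, q < N.+1 -> L q s -> L q (s \o tperm i0 i1) -> s i0 = s i1).
  split=> H q qN; have := H q qN.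
    by rewrite teval_imp => Hq Ls Ls'; apply: Hq; apply/teval_mul.
  by rewrite teval_imp => Hq /teval_mul[]; apply: Hq.
rewrite E1 E2 E3 E4 E5.
suff -> : teval v (TCyl i2 (tall i0
      (timp (TCyl i1 (TCyl i2 (tbigadd i0 N colour_class)))
            (tbigadd i0 N.+1 label_class)))) s c <->
  (exists f (_ : C), forall a (_ : C),
     let s' := upd (upd s i2 f) i0 a in
     (exists y (_ : C) u d',
        exists2 i, i < N & v i (upd (upd s' i1 y) i2 u) d') ->
     exists2 q, q < N.+1 & L q s') by [].
rewrite teval_cyl; split=> -[f [e H]]; exists f, e.
  move=> a d s' [y [e' [u [d' H']]]].
  have /teval_imp K := (teval_all _ _ _ _ _).1 H a d.
  apply: (teval_bigadd i0 v N.+1 label_class s' d).1; apply: K.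
  exists y, e', u, d'.
  exact: (teval_bigadd i0 v N colour_class (upd (upd s' i1 y) i2 u) d').2 H'.
apply/teval_all => a d.
apply/teval_imp => /teval_cyl[y [e' /teval_cyl[u [d' H']]]].
apply: (teval_bigadd i0 v N.+1 label_class _ d).2; apply: (H a d).
exists y, e', u, d'; exact: (teval_bigadd i0 v N colour_class _ d').1 H'.
Qed.

End Factorization.

(** With all coordinates but [i0] and [i1] fixed, the colour classes would
    violate [no_even_factorization]. *)
Lemma factorization_true_in_sets al (i0 i1 i2 : 'I_al) N M :
  i0 != i1 -> i0 != i2 -> i1 != i2 -> ~~ odd N -> 0 < N ->
  true_in (calg al M unit) (factorization_equation i0 i1 i2 N).
Proof.
move=> n01 n02 n12 Nev N_gt0 v; apply: calg_ext => s [].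
have -> : teval v (rhs (factorization_equation i0 i1 i2 N)) s tt <-> False.
  by split=> // H; apply: H.
split=> // /teval_mul[vs /teval_all H].
pose S x y u := upd (upd (upd s i0 x) i1 y) i2 u.
have S0 x y u : S x y u i0 = x by rewrite /S /upd (negPf n02) (negPf n01) eqxx.
have S1 x y u : S x y u i1 = y by rewrite /S /upd (negPf n12) eqxx.
have SU0 x y u z : upd (S x y u) i0 z = S z y u.
  apply: funext => j; rewrite /S /upd; have [->|] := eqVneq j i0 => //.
  by rewrite (negPf n02) (negPf n01).
have SU1 x y u z : upd (S x y u) i1 z = S x z u.
  apply: funext => j; rewrite /S /upd; have [->|] := eqVneq j i1 => //.
  by rewrite (negPf n12).
have SU2 x y u z : upd (S x y u) i2 z = S x y z.
  by apply: funext => j; rewrite /S /upd; case: (eqVneq j i2).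
have SW x y u : S x y u \o tperm i0 i1 = S y x u.
  apply: funext => j; rewrite /=; case: tpermP => [->|->|].
  - by rewrite S0 S1.
  - by rewrite S0 S1.
  - by move=> /eqP/negPf j0 /eqP/negPf j1; rewrite /S /upd j0 j1.
have HS x y u := (teval_factorization i0 i1 i2 N v (S x y u) tt).1
  ((teval_all v i2 _ _ tt).1 ((teval_all v i1 _ _ tt).1 (H x tt) y tt) u tt).
have [_ [_ [_ [_ [_ [f [_ bound]]]]]]] := HS (s i0) (s i1) (s i2).
pose R (i : 'I_N) x y := v i (S x y (s i2)) tt.
pose Q (q : 'I_N.+1) x := exists b, v (N + q) (S x b f) tt.
have sE : s = S (s i0) (s i1) (s i2).
  apply: funext => j; rewrite /S /upd.
  by case: eqVneq => [->|_] //; case: eqVneq => [->|_] //;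
    case: eqVneq => [->|].
apply: (@no_even_factorization N M R Q Nev _ _ _ _ _ _
  (Ordinal N_gt0) (s i0) (s i1)).
- move=> i x y; have [sym _] := HS x y (s i2); rewrite /R.
  by move=> /(sym i (ltn_ord i)); rewrite SW.
- move=> i j x y; have [_ [tot _]] := HS x y (s i2); rewrite /R.
  move=> /(tot i (ltn_ord i) j (ltn_ord j))[y' [[]]]; rewrite SU1.
  by exists y'.
- move=> i j x y; have [_ [_ [dis _]]] := HS x y (s i2); rewrite /R.
  by move=> vi vj; apply/val_inj/(dis i (ltn_ord i) j (ltn_ord j)).
- move=> i x; have [_ [_ [_ [irr _]]]] := HS x x (s i2); rewrite /R.
  by move=> /(irr i (ltn_ord i)); rewrite S0 S1.
- move=> i x y Rxy; have [] := bound x tt.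
    exists y, tt, (s i2), tt, i => //.
    by rewrite SU2 SU0 SU1 SU2.
  move=> q qN [b [[]]]; rewrite SU2 SU0 SU1 => Lq.
  by exists (Ordinal qN), b.
- move=> q x y [b Lx] [b' Ly].
  have [_ [_ [_ [_ [inj _]]]]] := HS x y f; rewrite S0 S1 SW in inj.
  by apply: (inj q (ltn_ord q)); [exists b, tt|exists b', tt]; rewrite SU1.
- by rewrite /R -sE.
Qed.

(** The colour classes are those of the generic sequences with vertices at [i0]
    and [i1], and the labels are the ones given by the labelling at [i2]. *)
Lemma factorization_fails al (i0 i1 i2 : 'I_al) N :
  i0 != i1 -> i0 != i2 -> i1 != i2 -> 0 < N ->
  exists v : nat -> calg al (node N) 'I_N,
    (forall x, admissible id (v x)) /\
    teval v (lhs (factorization_equation i0 i1 i2 N))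
    <> teval v (rhs (factorization_equation i0 i1 i2 N)).
Proof.
move=> n01 n02 n12 N_gt0.
pose X i (s : 'I_al -> node N) (c : 'I_N) :=
  [/\ generic s, is_vertex (s i0), is_vertex (s i1) & c = i :> nat].
pose T q (s : 'I_al -> node N) (c : 'I_N) : Prop :=
  labels (s i2) (s i0) (inord q).
pose v x : calg al (node N) 'I_N := if x < N then X x else T (x - N).
have vX i : i < N -> v i = X i by rewrite /v => ->.
have vT q : v (N + q) = T q by rewrite /v ltnNge leq_addr addKn.
exists v; split.
  move=> x; rewrite /v; case: ifP => _; split.
  - by move=> s c d cd [sG s0 s1 cx]; split=> //; rewrite -(cd sG).
  - move=> g s c gA; have [_ gv _ _] := gA.
    by rewrite /X /= !gv; split=> -[/(generic_automorphism s gA)].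
  - by [].
  - by move=> g s c [_ _ _ gn]; rewrite /T /= gn.
have holds s c : teval v (factorization i0 i1 i2 N) s c.
  have LE q s' : (exists b d, v (N + q) (upd s' i1 b) d) <->
      labels (s' i2) (s' i0) (inord q).
    have E b d : v (N + q) (upd s' i1 b) d = labels (s' i2) (s' i0) (inord q).
      by rewrite vT /T /upd ![_ == i1]eq_sym (negPf n12) eq_sym (negPf n01).
    by split=> [[b [d]]|H]; [rewrite E|exists (s' i2), c; rewrite E].
  apply/teval_factorization; split; [|split; [|split; [|split; [|split]]]].
  - move=> i iN; rewrite vX // => -[sG s0 s1 ci]; split=> //=.
    + exact/generic_tperm.
    + by rewrite tpermL.
    + by rewrite tpermR.
  - move=> i iN j jN; rewrite !vX // => -[sG s0 s1 cj].
    exists (s i1), (Ordinal iN); suff -> : upd s i1 (s i1) = s by [].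
    by apply: funext => l; rewrite /upd; case: eqP => [->|].
  - by move=> i iN j jN; rewrite !vX // => -[_ _ _ <-] [_ _ _ <-].
  - move=> i iN; rewrite vX // => -[[s_inj _ _] _ _ _] /s_inj/eqP.
    by rewrite (negPf n01).
  - move=> q qN; rewrite !LE /= tpermL tpermD //.
    case: (s i2) (s i0) (s i1) => [x|f|m] [y|g|m'] [z|h|m''] //=.
    move=> /eqP fy /eqP fz.
    by have -> : y = z by apply: (perm_inj (s := f)); rewrite fy.
  - exists (Labelling 1%g), c => a d s' [y [_ [u [d' [i iN]]]]].
    rewrite vX // => -[_ + _ _].
    rewrite /s' /upd (negPf n02) (negPf n01) eqxx.
    case: a @s' => // x s' _; exists x => //; apply/LE.
    by rewrite /s' /upd (negPf n02) eq_sym (negPf n02) !eqxx /= perm1 inord_val.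
pose s (j : 'I_al) : node N := if j == i0 then Vertex ord0
  else if j == i1 then Vertex ord_max else Filler j.
have sE j : s j = Vertex ord0 /\ j = i0 \/ s j = Vertex ord_max /\ j = i1
    \/ s j = Filler j /\ j != i0 /\ j != i1.
  rewrite /s; have [->|j0] := eqVneq j i0; first by left.
  by have [->|j1] := eqVneq j i1; [right; left|right; right].
have sG : generic s.
  split.
  - move=> j k sjk; have [[sj jE]|[[sj jE]|[sj _]]] := sE j;
      have [[sk kE]|[[sk kE]|[sk _]]] := sE k;
      move: sjk; rewrite sj sk ?jE ?kE // => -[].
    + by move=> E; move: N_gt0; rewrite -E.
    + by move=> E; move: N_gt0; rewrite E.
    + exact: val_inj.
  - by move=> j; have [[->]|[[->]|[->]]] := sE j.
  - have -> : vertex_set s = [set i0; i1]%SET; last by rewrite cards2 n01.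
    apply/setP => j; rewrite !inE.
    have [[-> ->]|[[-> ->]|[-> [/negPf -> /negPf ->]]]] := sE j => //.
    + by rewrite eqxx.
    + by rewrite eqxx orbT.
move=> /(congr1 (fun Y => Y s (Ordinal N_gt0))) E.
suff : teval v (rhs (factorization_equation i0 i1 i2 N)) s (Ordinal N_gt0).
  by apply.
rewrite -E; apply/teval_mul; split.
  rewrite /= vX //; split=> //; first by rewrite /s eqxx.
  by rewrite /s eq_sym (negPf n01) eqxx.
by do 3!(apply/teval_all => ? ?).
Qed.

(** * True equations that hold in the split algebra *)

Section Transfer.
Variables (al N : nat) (e : equation al).
Hypotheses (al_gt0 : 0 < al) (N_gt0 : 0 < N).
Hypothesis e_true : forall M, true_in (calg al M unit) e.
Variable v : nat -> calg al (node N) 'I_N.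
Hypothesis v_adm : forall x, admissible id (v x).

Lemma swap_free_holds :
  (forall i j, ~~ (has_swap i j (lhs e) || has_swap i j (rhs e))) ->
  teval v (lhs e) = teval v (rhs e).
Proof.
move=> free; apply: calg_ext => s c.
have rich := @skew_colouring_rich al N N_gt0.
have [s' ss'] := rich_cover s c al_gt0 rich.
apply: (@coloured_transfer al _ _ _ _ id
  (skew_colouring N_gt0) v e (@e_true _) (admissible_closed al id)
  _ _ _ _ _ _ s' ss') => //.
- by move=> i j ij; have := free i j; rewrite ij.
- by move=> k _; apply: rich_lines_full.
- by move=> *; apply: inj_id.
Qed.

Lemma diag_free_holds :
  (forall l m, ~~ (has_diag l m (lhs e) || has_diag l m (rhs e))) ->
  teval v (lhs e) = teval v (rhs e).
Proof.
move=> free; apply: calg_ext => s c; pose j := Ordinal al_gt0.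
have [t tc] := blowup_colouring_upd N_gt0 (fun l => (s l, 0)) j (s j) c.
pose s' := upd (fun l => (s l, 0)) j (s j, t).
apply: (@coloured_transfer al _ _ _ _ fst
  (blowup_colouring N_gt0) v e (@e_true _) (admissible_closed al id)
  _ _ _ _ _ _ s' _) => //.
- by move=> i k _ u; apply: blowup_colouring_tperm.
- by move=> k _; apply: blowup_lines_full.
- by move=> l m lm; have := free l m; rewrite lm.
- move=> Y _; rewrite tc; suff -> : fst \o s' = s by [].
  by apply: funext => l; rewrite /s' /upd /=; case: eqP => [->|].
Qed.

Lemma cyl_free_holds :
  (forall k, ~~ (has_cyl k (lhs e) || has_cyl k (rhs e))) ->
  teval v (lhs e) = teval v (rhs e).
Proof.
move=> free; apply: calg_ext => s c.
apply: (@coloured_transfer al _ _ _ _ id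
  (fun=> c) v e (@e_true _) (admissible_closed al id) _ _ _ _ _ _ s _) => //.
- by move=> k Hk; have := free k; rewrite Hk.
- by move=> *; apply: inj_id.
Qed.

(** Two colours are merged if no variable of the equation distinguishes them on
    generic sequences.  By homogeneity a variable is described there by one
    set of colours for each set of vertex positions, which bounds the number of
    merged colours independently of [N]. *)
Lemma few_variables_hold n :
  size (undup (eqn_vars e)) <= n ->
  2 * #|{ffun 'I_n * {set 'I_al} -> bool}| <= N ->
  teval v (lhs e) = teval v (rhs e).
Proof.
pose F := {ffun 'I_n * {set 'I_al} -> bool}; rewrite -[#|_|]/(#|F|) => few FN.
pose vars := undup (eqn_vars e).
(* By homogeneity, one sequence for a vertex set stands for all of them. *)
pose sig (c : 'I_N) : F := [ffun mA : 'I_n * {set 'I_al} =>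
  `[< exists s, [/\ generic s, vertex_set s = mA.2
                   & v (nth 0 vars mA.1) s c] >]].
have v_sig x : x \in eqn_vars e -> admissible sig (v x).
  move=> xe; split; last by have [] := v_adm x.
  move=> s c d cd vsc; have [sG|sNG] := pselect (generic s); last first.
    by have [vc _] := v_adm x; apply: vc vsc => /sNG.
  have xv : x \in vars by rewrite mem_undup.
  have ix : index x vars < n by apply: leq_trans few; rewrite index_mem.
  have /ffunP/(_ (Ordinal ix, vertex_set s)) := cd sG.
  rewrite !ffunE /= nth_index // => E.
  have : `[< exists s', [/\ generic s', vertex_set s' = vertex_set s
                            & v x s' d] >].
    by rewrite -E; apply/asboolP; exists s.
  move=> /asboolP[s' [s'G s's vs'd]].
  exact: (admissible_generic (v_adm x) s'G sG s's (erefl d)).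
pose rep m : 'I_N := if [pick c | enum_rank (sig c) == m :> nat] is Some c
  then c else Ordinal N_gt0.
have repP c : exists2 m, m < #|F| & sig (rep m) = sig c.
  exists (enum_rank (sig c)); first exact: ltn_ord.
  rewrite /rep; case: pickP => [d /eqP/val_inj/enum_rank_inj //|/(_ c)].
  by rewrite eqxx.
have rich := @symmetric_colouring_rich al N #|F| F sig rep FN repP.
apply: calg_ext => s c; have [s' ss'] := rich_cover s c al_gt0 rich.
apply: (@coloured_transfer al _ _ _ _ id
  (symmetric_colouring #|F| rep) v e (@e_true _)
  (admissible_closed al sig) _ _ _ _ _ _ s' ss') => //.
- by move=> i j _ s0; apply: symmetric_colouring_tperm.
- by move=> k _; apply: rich_lines_full.
- by move=> *; apply: inj_id.
Qed.

End Transfer.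

Theorem theorem1 (alpha : nat) (h_alpha : (3 <= alpha)%N)
    (Rel : Type) (ar : Rel -> nat)
    (h_ar : forall r : Rel, (ar r <= alpha)%N)
    (h_inf : infinite_set [set r : Rel | ar r = alpha])
    (Sigma : set (equation alpha))
    (h_Sigma : axiomatizes Sigma (Fm_plus_quot alpha ar))
    (n : nat) :
  exists e : equation alpha, Sigma e /\
    (exists xs : seq nat,
       [/\ size xs = n, uniq xs & {subset xs <= eqn_vars e}]) /\
    (exists i j : 'I_alpha, has_swap i j (lhs e) || has_swap i j (rhs e)) /\
    (exists k : 'I_alpha, has_cyl k (lhs e) || has_cyl k (rhs e)) /\
    (exists l m : 'I_alpha, has_diag l m (lhs e) || has_diag l m (rhs e)).
Proof.
apply: contrapT => none; have [sound complete] := h_Sigma.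
have al_gt0 : 0 < alpha by apply: leq_trans h_alpha.
pose i0 := Ordinal al_gt0.
pose i1 : 'I_alpha := Ordinal (leq_trans (isT : 1 < 3) h_alpha).
pose i2 : 'I_alpha := Ordinal h_alpha.
(* Even for the sake of the failing equation; large enough for the merging of
   colours in equations with at most [n] variables. *)
pose N := 2 * #|{ffun 'I_n * {set 'I_alpha} -> bool}|.
have N_gt0 : 0 < N.
  by rewrite muln_gt0; apply/card_gt0P; exists [ffun=> true].
have Nev : ~~ odd N by rewrite /N mul2n odd_double.
have [v [v_adm]] := @factorization_fails alpha i0 i1 i2 N isT isT isT N_gt0.
apply.
apply: (derives_sound (@admissible_closed alpha N _ id) _
  (complete (factorization_equation i0 i1 i2 N) _)) => //; last first.
  by apply: true_in_formulas => M; apply: factorization_true_in_sets.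
move=> e w Se w_adm; have e_true := true_in_sets al_gt0 h_inf (sound e Se).
have [few|many] := leqP (size (undup (eqn_vars e))) n.
  exact: few_variables_hold few _.
have [[i [j ij]]|noswap] := pselect (exists i j : 'I_alpha,
    has_swap i j (lhs e) || has_swap i j (rhs e)); last first.
  apply: swap_free_holds => // i j; apply/negP => ij.
  by apply: noswap; exists i, j.
have [[k Hk]|nocyl] := pselect (exists k : 'I_alpha,
    has_cyl k (lhs e) || has_cyl k (rhs e)); last first.
  by apply: cyl_free_holds => // k; apply/negP => Hk; apply: nocyl; exists k.
have [[l [m lm]]|nodiag] := pselect (exists l m : 'I_alpha,
    has_diag l m (lhs e) || has_diag l m (rhs e)); last first.
  apply: diag_free_holds => // l m; apply/negP => lm.
  by apply: nodiag; exists l, m.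
case: none; exists e; split=> //; split; last first.
  by split; [exists i, j|split; [exists k|exists l, m]].
exists (take n (undup (eqn_vars e))); split.
- by rewrite size_takel // ltnW.
- by rewrite take_uniq // undup_uniq.
- by move=> x /mem_take; rewrite mem_undup.
Qed.
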